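(* Let $K$ be a field of characteristic $p>0$ containing a primitive $m$th root of unity, where $m>1$ and $p\nmid m$; let $n\ge1$ with $p\nmid n$, and write $n\equiv i\pmod p$ with $0<i<p$. Let $G=G(m,m,n)$, take $\hbar=0$ and generic parameters, and let $J\subset A=K[x_1,\dots,x_n]$ be the unique maximal proper graded submodule of the Verma module $M(\mathrm{triv})=A$ of the rational Cherednik algebra $\mathbf{H}(G)$. Let $J'\subset A$ be the ideal generated by $e_1(x^m),\dots,e_n(x^m)$ and all squarefree monomials of degree $i$ in $x_1,\dots,x_n$, where $e_j(x^m)$ denotes the $j$th elementary symmetric function evaluated at $x_1^m,\dots,x_n^m$. Then $J'\subseteq J$.
   Context: $G(m,m,n)$ is the group of $n\times n$ monomial matrices over $K$ whose nonzero entries are $m$th roots of unity with product $1$, acting on $\mathfrak{h}=K^n$ and $\mathfrak{h}^*$ (dual coordinate bases $y_1,\dots,y_n$ and $x_1,\dots,x_n$). Its reflections (finite-order elements $s$ with $\operatorname{rank}(1-s)=1$) are $s_{ab}^k$ ($a<b$, $0\le k<m$): $x_a\mapsto\xi^kx_b$, $x_b\mapsto\xi^{-k}x_a$, other $x_\ell$ fixed, with $\xi$ a primitive $m$th root of unity. For a reflection $s$ choose $\alpha_s\in\mathfrak{h}^*$ spanning the image of $1-s$ and $\alpha_s^\vee\in\mathfrak{h}$ with $(1-s)x=(\alpha_s^\vee,x)\alpha_s$; let $c_s\in K$ depend only on the conjugacy class of $s$. Generic means the $c_s$ (one per conjugacy class of reflections) are algebraically independent over the prime field. $\mathbf{H}(G)$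 ($\hbar=0$) is the quotient of $K[G]\ltimes T(\mathfrak{h}\oplus\mathfrak{h}^* )$ by $[x,x']=0$, $[y,y']=0$, $[y,x]=-\sum_sc_s(y,\alpha_s)(x,\alpha_s^\vee)s$, graded by $\deg x=1$, $\deg y=-1$, $\deg g=0$. Its Verma module for the trivial representation is $A=\mathrm{Sym}(\mathfrak{h}^* )=K[x_1,\dots,x_n]$, with $A$ acting by multiplication, $G$ naturally, and $y\in\mathfrak{h}$ by the Dunkl operator $D_yf=-\sum_sc_s\frac{(y,\alpha_s)}{\alpha_s}(1-s)f$. *)

(* Defs.v *)
From HB Require Import structures.
From mathcomp Require Import all_boot all_order all_fingroup all_algebra.
From mathcomp Require Export mpoly.

Set Implicit Arguments.
Unset Strict Implicit.
Unset Printing Implicit Defensive.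

Import GRing.Theory.
Local Open Scope ring_scope.

(* A pair (sigma, d) encodes the monomial matrix with entry xi ^+ (d i) in
   position (i, sigma i) and zeros elsewhere. For xi a primitive m-th root of
   unity the encoding is faithful and reaches all of G(m,m,n), see gmx_inj and
   gmxP below; it makes G(m,m,n) and its set of reflections finTypes. *)
Record Gmmn (K : fieldType) (m n : nat) (xi : K) := MkGmmn {
  gval :> {perm 'I_n} * {ffun 'I_n -> 'I_m};
  gvalP : \prod_i xi ^+ (gval.2 i) == 1
}.
HB.instance Definition _ (K : fieldType) (m n : nat) (xi : K) :=
  [isSub for @gval K m n xi].
HB.instance Definition _ (K : fieldType) (m n : nat) (xi : K) :=
  [Finite of Gmmn m n xi by <:].

Definition gmx (K : fieldType) (m n : nat) (xi : K) (g : Gmmn m n xi) :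
    'M[K]_n :=
  \matrix_(i, j) (if j == g.1 i then xi ^+ (g.2 i) else 0).

Lemma gmx_inj (K : fieldType) (m n : nat) (xi : K) :
  m.-primitive_root xi -> injective (@gmx K m n xi).
Proof.
move=> xiP g h /matrixP egh; apply: val_inj.
have nz (k : nat) : xi ^+ k != 0.
  by rewrite expf_neq0 ?(prim_root_eq0 xiP) -?lt0n ?(prim_order_gt0 xiP).
have es i : g.1 i = h.1 i.
  have := egh i (g.1 i); rewrite !mxE eqxx.
  by case: eqP => // _ /eqP; rewrite (negPf (nz _)).
move: es egh; case: g h => [[s d] /= gP] [[t e] /= hP] /= es egh.
congr pair; first by apply/permP.
apply/ffunP=> i; have := egh i (s i); rewrite !mxE /= eqxx es eqxx => /eqP.
by rewrite (eq_prim_root_expr xiP) !modn_small // => /eqP /val_inj.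
Qed.

Lemma gmxP (K : fieldType) (m n : nat) (xi : K) (A : 'M[K]_n) :
  m.-primitive_root xi ->
  (exists g : Gmmn m n xi, gmx g = A) <->
  (exists s : {perm 'I_n},
     [/\ forall i j, (A i j != 0) = (j == s i),
         forall i, A i (s i) ^+ m = 1 & \prod_i A i (s i) = 1]).
Proof.
move=> xiP.
have nz (k : nat) : xi ^+ k != 0.
  by rewrite expf_neq0 ?(prim_root_eq0 xiP) -?lt0n ?(prim_order_gt0 xiP).
split=> [[[[s d] /= gP] <-] | [s [A0 Am A1]]].
  exists s; split=> [i j|i|].
  - by rewrite mxE /=; case: (j =P s i) => _; rewrite ?nz ?eqxx.
  - by rewrite mxE /= eqxx exprAC (prim_expr_order xiP) expr1n.
  - by rewrite -[RHS](eqP gP); apply: eq_bigr => i _; rewrite mxE /= eqxx.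
have dP i : {k : 'I_m | A i (s i) = xi ^+ k} by apply: (prim_rootP xiP).
pose d := [ffun i => sval (dP i)].
have dE i : xi ^+ d i = A i (s i) by rewrite ffunE -(svalP (dP i)).
have gP : \prod_i xi ^+ ((s, d).2 i) == 1.
  by apply/eqP; rewrite -[RHS]A1; apply: eq_bigr => i _; rewrite dE.
exists (MkGmmn gP); apply/matrixP=> i j; rewrite mxE /= dE.
by have := A0 i j; case: (j =P s i) => [-> // | _ /negbFE/eqP].
Qed.

Record refl (K : fieldType) (m n : nat) (xi : K) := MkRefl {
  rval :> Gmmn m n xi;
  rvalP : \rank (1%:M - gmx rval) == 1%N
}.
HB.instance Definition _ (K : fieldType) (m n : nat) (xi : K) :=
  [isSub for @rval K m n xi].
HB.instance Definition _ (K : fieldType) (m n : nat) (xi : K) :=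
  [Finite of refl m n xi by <:].

Definition conj_refl (K : fieldType) (m n : nat) (xi : K) (s t : refl m n xi) :
    Prop :=
  exists g : Gmmn m n xi, gmx g *m gmx s = gmx t *m gmx g.

Definition class_param (K : fieldType) (m n : nat) (xi : K)
    (c : refl m n xi -> K) : Prop :=
  forall s t : refl m n xi, conj_refl s t -> c s = c t.

Definition in_prime_field (K : fieldType) (x : K) : Prop :=
  exists a b : int, x = a%:~R / b%:~R.

Definition alg_indep (K : fieldType) (k : nat) (a : 'I_k -> K) : Prop :=
  forall P : {mpoly K[k]},
    (forall u : 'X_{1..k}, in_prime_field P@_u) -> P.@[a] = 0 -> P = 0.

(* One parameter per conjugacy class: algebraic independence is required of the
   values of c on every family of pairwise non-conjugate reflections. *)
Definition generic_param (K : fieldType) (m n : nat) (xi : K)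
    (c : refl m n xi -> K) : Prop :=
  class_param c /\
  forall (k : nat) (s : 'I_k -> refl m n xi),
    (forall j l : 'I_k, conj_refl (s j) (s l) -> j = l) ->
    alg_indep (fun j => c (s j)).

(* Vectors of h = K^n are columns y (coordinates in y_1, ..., y_n) and covectors
   of h^* are rows w (coordinates in x_1, ..., x_n). A matrix g acts on h by
   y |-> g *m y, hence on h^* by w |-> w *m invmx g. *)
Definition pairing (K : fieldType) (n : nat) (y : 'cV[K]_n) (w : 'rV[K]_n) : K :=
  (w *m y) 0 0.

Definition linform (K : fieldType) (n : nat) (w : 'rV[K]_n) : {mpoly K[n]} :=
  \sum_(i < n) w 0 i *: 'X_i.

Definition act (K : fieldType) (n : nat) (g : 'M[K]_n) (f : {mpoly K[n]}) :
    {mpoly K[n]} :=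
  f \mPo [tuple linform (row j (invmx g)) | j < n].

(* alpha_s: a nonzero element of the image of 1 - s on h^*, which is the row
   space of 1 - s^-1; see root_span. The Dunkl operators do not depend on its
   normalisation. *)
Definition root (K : fieldType) (m n : nat) (xi : K) (s : refl m n xi) :
  'rV[K]_n := nz_row (1%:M - invmx (gmx s)).

Lemma rank_refl_inv (K : fieldType) (m n : nat) (xi : K) (s : refl m n xi) :
  \rank (1%:M - invmx (gmx s)) = 1%N.
Proof.
have /eqP r1 := rvalP s; rewrite -[RHS]r1.
have [su|sNu] := boolP (gmx s \in unitmx); last by rewrite invmx_out.
have -> : 1%:M - invmx (gmx s) = - (invmx (gmx s) *m (1%:M - gmx s)).
  by rewrite mulmxBr mulmx1 mulVmx // opprB.
by rewrite mxrank_opp eqmxMfull // row_full_unit unitmx_inv.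
Qed.

Lemma root_span (K : fieldType) (m n : nat) (xi : K) (s : refl m n xi) :
  (root s == 1%:M - invmx (gmx s))%MS.
Proof.
have r1 := rank_refl_inv s.
rewrite -(geq_leqif (mxrank_leqif_eq (nz_row_sub _))) r1 lt0n mxrank_eq0.
by rewrite nz_row_eq0 -mxrank_eq0 r1.
Qed.

Lemma root_dvd (K : fieldType) (m n : nat) (xi : K) (s : refl m n xi)
    (f : {mpoly K[n]}) :
  exists q : {mpoly K[n]}, q * linform (root s) == f - act (gmx s) f.
Proof.
have linD (u v : 'rV[K]_n) : linform (u - v) = linform u - linform v.
  rewrite /linform -sumrB; apply: eq_bigr => i _.
  by rewrite !mxE scalerBl.
have linX j : linform (row j 1%:M) = 'X_j :> {mpoly K[n]}.
  rewrite /linform (bigD1 j) //= !mxE eqxx scale1r big1 ?addr0 // => i ij.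
  by rewrite !mxE eq_sym (negPf ij) scale0r.
elim/mpolyind: f => [|a u f _ _ [q /eqP qE]].
  by exists 0; rewrite /act raddf0 mul0r subrr.
suff [r rE] : exists r, r * linform (root s) = 'X_[u] - act (gmx s) 'X_[u].
  exists (a *: r + q); rewrite mulrDl qE -scalerAl rE /act comp_mpolyD comp_mpolyZ.
  by rewrite scalerBr opprD addrACA.
rewrite mpolyXE_id; pose P (h : {mpoly K[n]}) :=
  exists r, r * linform (root s) = h - act (gmx s) h.
have P1 : P 1 by exists 0; rewrite /act rmorph1 subrr mul0r.
have PM g h : P g -> P h -> P (g * h).
  move=> [q1 e1] [q2 e2]; exists (q1 * h + act (gmx s) g * q2).
  rewrite mulrDl -mulrA [h * _]mulrC mulrA e1 -mulrA e2 /act rmorphM /=.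
  by rewrite mulrBl mulrBr addrA subrK.
have PX j : P 'X_j.
  have /sub_rVP [b bE] : (row j (1%:M - invmx (gmx s)) <= root s)%MS.
    by rewrite (eqmxP (root_span s)) row_sub.
  exists b%:MP; rewrite /act comp_mpolyXU -tnth_nth tnth_mktuple -linX -linD.
  rewrite -linearB /= bE mul_mpolyC /linform scaler_sumr.
  by apply: eq_bigr => i _; rewrite !mxE scalerA.
apply: (big_ind P) => // j _; elim: (u j) => [|k IH]; first exact: P1.
by rewrite exprS; apply: PM.
Qed.

(* The exact quotient (1 - s) f / alpha_s in K[x_1, ..., x_n]. *)
Definition divdiff (K : fieldType) (m n : nat) (xi : K) (s : refl m n xi)
    (f : {mpoly K[n]}) : {mpoly K[n]} :=
  xchoose (root_dvd s f).

Definition dunkl (K : fieldType) (m n : nat) (xi : K) (c : refl m n xi -> K)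
    (y : 'cV[K]_n) (f : {mpoly K[n]}) : {mpoly K[n]} :=
  - \sum_(s : refl m n xi) (c s * pairing y (root s)) *: divdiff s f.

Lemma root_neq0 (K : fieldType) (m n : nat) (xi : K) (s : refl m n xi) :
  linform (root s) != 0.
Proof.
apply: contraTneq (rvalP s) => l0.
suff r0 : root s = 0.
  by move: (rank_refl_inv s); rewrite -(eqmxP (root_span s)) r0 mxrank0.
apply/rowP=> k; have /(congr1 (mcoeff U_(k))) := l0.
rewrite mcoeff0 raddf_sum /= (bigD1 k) //= mcoeffZ mcoeffX eqxx mulr1 big1.
  by rewrite addr0 mxE.
by move=> j jk; rewrite mcoeffZ mcoeffXU (negPf jk) mulr0.
Qed.

Lemma divdiffE (K : fieldType) (m n : nat) (xi : K) (s : refl m n xi)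
    (f : {mpoly K[n]}) :
  divdiff s f * linform (root s) = f - act (gmx s) f.
Proof. exact: (eqP (xchooseP (root_dvd s f))). Qed.

Lemma act_linform (K : fieldType) (n : nat) (g : 'M[K]_n) (w : 'rV[K]_n) :
  act g (linform w) = linform (w *m invmx g).
Proof.
rewrite /act {1}/linform raddf_sum /=.
under eq_bigr => j _ do
  rewrite comp_mpolyZ comp_mpolyXU -tnth_nth tnth_mktuple scaler_sumr.
rewrite exchange_big /=; apply: eq_bigr => k _; rewrite mxE scaler_suml.
by apply: eq_bigr => j _; rewrite !mxE scalerA.
Qed.

(* The defining relation [y, w] = - \sum_s c_s (y, alpha_s) (w, alpha_s^vee) s
   of H(G), checked on K[x_1, ..., x_n]. *)
Lemma dunkl_comm (K : fieldType) (m n : nat) (xi : K) (c : refl m n xi -> K)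
    (coroot : refl m n xi -> 'cV[K]_n) :
  (forall (s : refl m n xi) (w : 'rV[K]_n),
     w - w *m invmx (gmx s) = pairing (coroot s) w *: root s) ->
  forall (y : 'cV[K]_n) (w : 'rV[K]_n) (f : {mpoly K[n]}),
    dunkl c y (linform w * f) - linform w * dunkl c y f =
    - \sum_(s : refl m n xi)
        (c s * pairing y (root s) * pairing (coroot s) w) *: act (gmx s) f.
Proof.
move=> corootP y w f; rewrite /dunkl mulrN -opprD; congr (- _).
rewrite mulr_sumr -sumrB; apply: eq_bigr => s _.
rewrite -scalerAr -scalerBr -scalerA; congr (_ *: _).
apply: (mulIf (root_neq0 s)).
rewrite mulrBl -mulrA !divdiffE /act rmorphM /= -!/(act _ _) act_linform.
rewrite -scalerAl [X in _ = _ *: X]mulrC scalerAl.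
have -> : pairing (coroot s) w *: linform (root s) =
          linform w - linform (w *m invmx (gmx s)).
  rewrite /linform -sumrB scaler_sumr; apply: eq_bigr => k _.
  rewrite scalerA -scalerBl; congr (_ *: _).
  by have /rowP/(_ k) := corootP s w; rewrite !mxE => <-.
by rewrite mulrBr mulrBl opprB [LHS]addrC addrA subrK.
Qed.

Lemma dunklD (K : fieldType) (m n : nat) (xi : K) (c : refl m n xi -> K)
    (y : 'cV[K]_n) : {morph dunkl c y : f g / f + g}.
Proof.
move=> f g; rewrite /dunkl -opprD -big_split /=; congr (- _).
apply: eq_bigr => s _; rewrite -scalerDr; congr (_ *: _).
apply: (mulIf (root_neq0 s)); rewrite mulrDl !divdiffE /act comp_mpolyD.
by rewrite opprD addrACA.
Qed.

(* A predicate N is an H(G)-submodule of the Verma module K[x_1, ..., x_n] when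
   it is stable under the generators of H(G): the x's (equivalently, all
   multiplications by polynomials), the group and the Dunkl operators. *)
Record is_submodule (K : fieldType) (m n : nat) (xi : K)
    (c : refl m n xi -> K) (N : {mpoly K[n]} -> Prop) : Prop := {
  submod_zero : N 0;
  submod_add : forall f g : {mpoly K[n]}, N f -> N g -> N (f + g);
  submod_mul : forall f g : {mpoly K[n]}, N g -> N (f * g);
  submod_act : forall (g : Gmmn m n xi) (f : {mpoly K[n]}),
    N f -> N (act (gmx g) f);
  submod_dunkl : forall (y : 'cV[K]_n) (f : {mpoly K[n]}),
    N f -> N (dunkl c y f)
}.

Definition is_graded (K : fieldType) (n : nat) (N : {mpoly K[n]} -> Prop) :
    Prop :=
  forall (d : nat) (f : {mpoly K[n]}), N f -> N (pihomog mdeg d f).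

Definition proper_graded_submodule (K : fieldType) (m n : nat) (xi : K)
    (c : refl m n xi -> K) (N : {mpoly K[n]} -> Prop) : Prop :=
  [/\ is_submodule c N, is_graded N & exists f : {mpoly K[n]}, ~ N f].

Definition maximal_proper_graded_submodule (K : fieldType) (m n : nat) (xi : K)
    (c : refl m n xi -> K) (N : {mpoly K[n]} -> Prop) : Prop :=
  proper_graded_submodule c N /\
  forall N' : {mpoly K[n]} -> Prop, proper_graded_submodule c N' ->
    (forall f, N f -> N' f) -> forall f, N' f -> N f.

Lemma pgs_coef0 (K : fieldType) (m n : nat) (xi : K) (c : refl m n xi -> K)
    (N : {mpoly K[n]} -> Prop) (f : {mpoly K[n]}) :
  proper_graded_submodule c N -> N f -> f@_0%MM = 0.
Proof.
case=> Ns Ng [g NNg] Nf; apply/eqP/negP => /negP f0; apply: NNg.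
have := Ng 0%N _ Nf.
suff -> : pihomog mdeg 0 f = (f@_0%MM)%:MP.
  move=> /(submod_mul Ns (g * ((f@_0%MM)^-1)%:MP)).
  by rewrite -mulrA -mpolyCM mulVf // mulr1.
rewrite /pihomog (eq_bigl (fun u => u == 0%MM)); last by move=> u; rewrite mdeg_eq0.
rewrite -big_filter filter_pred1_uniq ?msupp_uniq //; last by rewrite mcoeff_msupp.
by rewrite big_seq1 mpolyX0 alg_mpolyC.
Qed.

Lemma maximal_proper_graded_submodule_exists (K : fieldType) (m n : nat)
    (xi : K) (c : refl m n xi -> K) :
  exists J : {mpoly K[n]} -> Prop,
    maximal_proper_graded_submodule c J /\
    forall J2, maximal_proper_graded_submodule c J2 -> forall f, J f <-> J2 f.
Proof.
pose J f := exists N, proper_graded_submodule c N /\ N f.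
have d0 y : dunkl c y 0 = 0.
  by apply: (addrI (dunkl c y 0)); rewrite -dunklD !addr0.
have JP : proper_graded_submodule c J.
  split; [split | | ].
  - exists (fun f => f = 0); split=> //; split; last by exists 1; apply/eqP/oner_neq0.
      split=> // [_ _ -> -> | f _ -> | g _ -> | y _ ->]; rewrite ?addr0 ?mulr0 //.
      by rewrite /act raddf0.
    by move=> d _ ->; rewrite raddf0.
  - move=> f g [N1 [p1 n1]] [N2 [p2 n2]].
    exists (fun h => exists h1 h2, [/\ N1 h1, N2 h2 & h = h1 + h2]).
    split; last by exists f, g.
    case: (p1) (p2) => [s1 g1 _] [s2 g2 _]; split; last 1 first.
    + exists 1 => -[h1 [h2 [/(pgs_coef0 p1) e1 /(pgs_coef0 p2) e2 E]]].
      have := congr1 (mcoeff 0%MM) E; rewrite mcoeffD e1 e2 addr0 mcoeff1 eqxx.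
      by apply/eqP/oner_neq0.
    + split.
      * by exists 0, 0; rewrite addr0; split=> //; [apply: submod_zero s1|apply: submod_zero s2].
      * move=> _ _ [a [b [A B ->]]] [a' [b' [A' B' ->]]].
        exists (a + a'), (b + b'); rewrite addrACA.
        by split; [apply: (submod_add s1)|apply: (submod_add s2)|].
      * move=> q _ [a [b [A B ->]]]; exists (q * a), (q * b); rewrite mulrDr.
        by split; [apply: (submod_mul s1)|apply: (submod_mul s2)|].
      * move=> q _ [a [b [A B ->]]]; exists (act (gmx q) a), (act (gmx q) b).
        by rewrite /act comp_mpolyD; split; [apply: (submod_act s1)|apply: (submod_act s2)|].
      * move=> q _ [a [b [A B ->]]]; exists (dunkl c q a), (dunkl c q b).
        by rewrite dunklD; split; [apply: (submod_dunkl s1)|apply: (submod_dunkl s2)|].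
    + move=> d _ [a [b [A B ->]]]; exists (pihomog mdeg d a), (pihomog mdeg d b).
      by rewrite raddfD; split; [apply: g1|apply: g2|].
  - by move=> f g [N [pN Ng]]; exists N; split=> //; case: pN => s _ _; apply: (submod_mul s).
  - by move=> g f [N [pN Ng]]; exists N; split=> //; case: pN => s _ _; apply: (submod_act s).
  - by move=> y f [N [pN Ng]]; exists N; split=> //; case: pN => s _ _; apply: (submod_dunkl s).
  - by move=> d f [N [pN Ng]]; exists N; split=> //; case: pN => _ s _; apply: s.
  - exists 1 => -[N [pN /(pgs_coef0 pN)]]; rewrite mcoeff1 eqxx.
    by apply/eqP/oner_neq0.
exists J; split; first by split=> // N' pN' _ f Nf; exists N'.
move=> J2 [p2 m2] f; split=> [Jf|J2f]; last by exists J2.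
by apply: (m2 J JP) => // g J2g; exists J2.
Qed.

Definition ideal_gen (K : fieldType) (n : nat) (S : {mpoly K[n]} -> Prop)
    (f : {mpoly K[n]}) : Prop :=
  exists (k : nat) (a g : 'I_k -> {mpoly K[n]}),
    (forall j, S (g j)) /\ f = \sum_j a j * g j.

Definition elem_xm (K : fieldType) (m n j : nat) : {mpoly K[n]} :=
  mesym n K j \mPo [tuple 'X_k ^+ m | k < n].

Definition sqfree_monomial (n : nat) (u : 'X_{1..n}) : Prop :=
  forall k : 'I_n, (u k <= 1)%N.

Definition J'_gen (K : fieldType) (m n i : nat) (f : {mpoly K[n]}) : Prop :=
  (exists j : nat, (1 <= j <= n)%N /\ f = elem_xm K m n j) \/
  (exists u : 'X_{1..n}, [/\ sqfree_monomial u, mdeg u = i & f = 'X_[u]]).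

Definition J' (K : fieldType) (m n i : nat) : {mpoly K[n]} -> Prop :=
  ideal_gen (J'_gen m i).

(* Main.v *)
Require Import Defs.
From HB Require Import structures.
From mathcomp Require Import all_boot all_order all_fingroup all_algebra.

Set Implicit Arguments.
Unset Strict Implicit.
Unset Printing Implicit Defensive.

Import GRing.Theory.
Local Open Scope ring_scope.

(* The ideal J' is itself a proper graded submodule, and the sum of two proper
   graded submodules is proper, so J' lies in the maximal one. Since J' is
   generated by homogeneous elements of positive degree which G permutes up to
   scalars, it suffices that the Dunkl operators kill the generators. They kill
   the e_j(x^m) because these are G-invariant. For a squarefree monomial x^S
   with |S| = i, the operator D_{y_a} gives -m c (n - i) x^{S \ a} when a is in
   S, which vanishes as n = i mod p, and otherwise a combination of the
   x^{S \ b} with coefficient c times the sum of all m-th roots of unity. If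
   S is not everything then n >= i + p >= 3, so that all reflections are
   conjugate and carry the same parameter c. *)

(** * Ideals generated by a set of polynomials *)

Section IdealGen.

Variables (K : fieldType) (n : nat) (S : {mpoly K[n]} -> Prop).

Lemma ideal_gen0 : ideal_gen S 0.
Proof.
exists 0%N, (fun _ => 0), (fun _ => 0); split; first by case.
by rewrite big_ord0.
Qed.

Lemma ideal_gen_mem g : S g -> ideal_gen S g.
Proof.
move=> Sg; exists 1%N, (fun _ => 1), (fun _ => g); split=> //.
by rewrite big_ord1 mul1r.
Qed.

Lemma ideal_genM h f : ideal_gen S f -> ideal_gen S (h * f).
Proof.
move=> [k [a [g [Sg ->]]]]; exists k, (fun j => h * a j), g; split=> //.
by rewrite mulr_sumr; apply: eq_bigr => j _; rewrite mulrA.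
Qed.

Lemma ideal_genZ b f : ideal_gen S f -> ideal_gen S (b *: f).
Proof. by rewrite -mul_mpolyC; apply: ideal_genM. Qed.

Lemma ideal_genD f h : ideal_gen S f -> ideal_gen S h -> ideal_gen S (f + h).
Proof.
move=> [k [a [g [Sg ->]]]] [l [b [t [St ->]]]].
exists (k + l)%N, (fun j => match split j with inl x => a x | inr x => b x end),
  (fun j => match split j with inl x => g x | inr x => t x end); split.
  by move=> j; case: (split j).
rewrite big_split_ord /=; congr (_ + _); apply: eq_bigr => j _.
  by rewrite (unsplitK (inl j)).
by rewrite (unsplitK (inr j)).
Qed.

Lemma ideal_gen_sum (I : Type) (r : seq I) (P : pred I)
    (F : I -> {mpoly K[n]}) :
  (forall i, P i -> ideal_gen S (F i)) ->
  ideal_gen S (\sum_(i <- r | P i) F i).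
Proof. exact: (big_ind _ ideal_gen0 ideal_genD). Qed.

Lemma ideal_gen_ind (N : {mpoly K[n]} -> Prop) f :
  N 0 -> (forall g h, N g -> N h -> N (g + h)) ->
  (forall a g, S g -> N (a * g)) -> ideal_gen S f -> N f.
Proof.
by move=> N0 ND NM [k [a [g [Sg ->]]]]; apply: (big_ind N) => // j _; apply: NM.
Qed.

(** Once the multiplier is expanded into monomials, every product with a homogeneous generator is
    homogeneous, so projecting to degree [d] either keeps it or kills it. *)
Lemma ideal_gen_graded :
  (forall g, S g -> exists d, g \is d.-homog) -> is_graded (ideal_gen S).
Proof.
move=> hS d f;
apply: (@ideal_gen_ind (fun f => ideal_gen S (pihomog mdeg d f))).
- by rewrite raddf0; apply: ideal_gen0.
- by move=> g h; rewrite raddfD; apply: ideal_genD.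
move=> a g Sg; have [e ge] := hS _ Sg.
rewrite (mpolyE a) mulr_suml raddf_sum; apply: ideal_gen_sum => u _ /=.
have ug : a@_u *: 'X_[u] * g \is (mdeg u + e).-homog.
  by apply: dhomogM => //; apply: dhomogZ; rewrite dhomogX.
have [<-|ne] := eqVneq (mdeg u + e)%N d; last first.
  by rewrite (pihomog_ne0 ne ug); apply: ideal_gen0.
by rewrite pihomog_dE //; apply/ideal_genM/ideal_gen_mem.
Qed.

Lemma ideal_gen_coef0 f :
  (forall g, S g -> g@_0%MM = 0) -> ideal_gen S f -> f@_0%MM = 0.
Proof.
move=> S0.
apply: (@ideal_gen_ind (fun f => f@_0%MM = 0)) => [|g h g0 h0|a g /S0 g0].
- by rewrite mcoeff0.
- by rewrite mcoeffD g0 h0 addr0.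
by rewrite rmorphM /= g0 mulr0.
Qed.

End IdealGen.

(** * Submodules of the Verma module given by generators, and the maximal one *)

Section Submodules.

Variables (K : fieldType) (m n : nat) (xi : K) (c : refl m n xi -> K).

(** Twisted Leibniz rule, from $(1-s)(hf) = h\,(1-s)f + ((1-s)h)\,sf$. *)
Lemma dunkl_mul y (h f : {mpoly K[n]}) :
  dunkl c y (h * f) = h * dunkl c y f -
    \sum_s (c s * pairing y (Defs.root s)) *:
      (divdiff s h * Defs.act (gmx s) f).
Proof.
rewrite /dunkl mulrN mulr_sumr -opprD -big_split /=; congr (- _).
apply: eq_bigr => s _; rewrite -scalerAr -scalerDr; congr (_ *: _).
apply: (mulIf (root_neq0 s)); apply: etrans (divdiffE s (h * f)) _.
have := divdiffE s h; have := divdiffE s f.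
have -> : Defs.act (gmx s) (h * f) = Defs.act (gmx s) h * Defs.act (gmx s) f.
  exact: rmorphM.
move: (divdiff s f) (divdiff s h) (linform _).
move: (Defs.act _ f) (Defs.act _ h) => sf sh qf qh l ef eh.
by rewrite mulrDl [qh * sf * l]mulrAC eh -mulrA ef mulrBr mulrBl addrA subrK.
Qed.

Lemma dunkl0 y : dunkl c y 0 = 0.
Proof. by apply: (addrI (dunkl c y 0)); rewrite -dunklD !addr0. Qed.

(** When $D_y g = 0$, the twisted Leibniz rule turns $D_y(ag)$ into a combination of the $sg$, which
    stay in the ideal. Generators of positive degree have no constant term, so 1 is not reached. *)
Lemma ideal_gen_pgs (S : {mpoly K[n]} -> Prop) :
  (forall g, S g -> exists2 d, (0 < d)%N & g \is d.-homog) ->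
  (forall y g, S g -> dunkl c y g = 0) ->
  (forall (s : Gmmn m n xi) g, S g -> ideal_gen S (Defs.act (gmx s) g)) ->
  proper_graded_submodule c (ideal_gen S).
Proof.
move=> hS dS aS; split; [split | | ].
- exact: ideal_gen0.
- exact: ideal_genD.
- exact: ideal_genM.
- move=> s f.
  apply: (@ideal_gen_ind _ _ S (fun f => ideal_gen S (Defs.act (gmx s) f))).
  + by rewrite /Defs.act raddf0; apply: ideal_gen0.
  + by move=> g h; rewrite /Defs.act raddfD; apply: ideal_genD.
  by move=> a g /(aS s); rewrite /Defs.act rmorphM /=; apply: ideal_genM.
- move=> y f.
  apply: (@ideal_gen_ind _ _ S (fun f => ideal_gen S (dunkl c y f))).
  + by rewrite dunkl0; apply: ideal_gen0.
  + by move=> g h; rewrite dunklD; apply: ideal_genD.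
  move=> a g Sg; rewrite dunkl_mul dS // mulr0 sub0r -scaleN1r.
  apply/ideal_genZ/ideal_gen_sum => s _.
  exact/ideal_genZ/ideal_genM/aS.
- by apply: ideal_gen_graded => g /hS [d _ gd]; exists d.
exists 1 => /ideal_gen_coef0 one0; suff: (1 : {mpoly K[n]})@_0%MM = 0.
  by rewrite mcoeff1 eqxx; apply/eqP/oner_neq0.
apply: one0 => g /hS[d d0 gd]; apply: (dhomog_nemf_coeff gd).
by rewrite /= mdeg0 eq_sym -lt0n.
Qed.

Lemma pgs_add N1 N2 :
  proper_graded_submodule c N1 -> proper_graded_submodule c N2 ->
  proper_graded_submodule c
    (fun h => exists h1 h2, [/\ N1 h1, N2 h2 & h = h1 + h2]).
Proof.
move=> p1 p2; have [s1 g1 _] := p1; have [s2 g2 _] := p2.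
split; [split | | ].
- exists 0, 0; rewrite addr0.
  by split=> //; [apply: submod_zero s1 | apply: submod_zero s2].
- move=> _ _ [a [b [A B ->]]] [a' [b' [A' B' ->]]].
  exists (a + a'), (b + b'); rewrite addrACA.
  by split; [apply: (submod_add s1) | apply: (submod_add s2) |].
- move=> q _ [a [b [A B ->]]]; exists (q * a), (q * b); rewrite mulrDr.
  by split; [apply: (submod_mul s1) | apply: (submod_mul s2) |].
- move=> q _ [a [b [A B ->]]].
  exists (Defs.act (gmx q) a), (Defs.act (gmx q) b).
  rewrite /Defs.act comp_mpolyD.
  by split; [apply: (submod_act s1) | apply: (submod_act s2) |].
- move=> y _ [a [b [A B ->]]]; exists (dunkl c y a), (dunkl c y b).
  rewrite dunklD.
  by split; [apply: (submod_dunkl s1) | apply: (submod_dunkl s2) |].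
- move=> d _ [a [b [A B ->]]].
  exists (pihomog mdeg d a), (pihomog mdeg d b); rewrite raddfD.
  by split; [apply: g1 | apply: g2 |].
(* Elements of both submodules have zero constant term, hence so do their sums, and 1 is
   excluded. *)
exists 1 => -[h1 [h2 [/(pgs_coef0 p1) e1 /(pgs_coef0 p2) e2 E]]].
have := congr1 (mcoeff 0%MM) E; rewrite mcoeffD e1 e2 addr0 mcoeff1 eqxx.
exact/eqP/oner_neq0.
Qed.

(** The sum $J+N$ is again proper and contains $J$, so maximality forces it back into $J$. *)
Lemma pgs_sub_maximal (J N : {mpoly K[n]} -> Prop) f :
  maximal_proper_graded_submodule c J -> proper_graded_submodule c N ->
  N f -> J f.
Proof.
move=> [pJ maxJ] pN Nf; have [sJ _ _] := pJ; have [sN _ _] := pN.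
apply: (maxJ _ (pgs_add pJ pN)) => [g Jg|].
  by exists g, 0; rewrite addr0; split=> //; apply: submod_zero sN.
by exists 0, f; rewrite add0r; split=> //; apply: submod_zero sJ.
Qed.

End Submodules.

(** * The monomial action of $G$ on variables, squarefree monomials and $e_j(x^m)$ *)

Lemma prim_expr_neq0 (F : fieldType) (m k : nat) (z : F) :
  m.-primitive_root z -> z ^+ k != 0.
Proof.
move=> zP.
by rewrite expf_neq0 ?(prim_root_eq0 zP) -?lt0n ?(prim_order_gt0 zP).
Qed.

Section MonomialAction.

Variables (K : fieldType) (n : nat).

Lemma act_var (g : 'M[K]_n) j :
  Defs.act g 'X_j = linform (row j (invmx g)).
Proof. by rewrite /Defs.act comp_mpolyXU -tnth_nth tnth_mktuple. Qed.

Lemma linform_delta (w : 'rV[K]_n) j a :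
  (forall k, w 0 k = if k == j then a else 0) -> linform w = a *: 'X_j.
Proof.
move=> wE; rewrite /linform (bigD1 j) //= wE eqxx big1 ?addr0 // => k kj.
by rewrite wE (negPf kj) scale0r.
Qed.

Lemma invmx_uniq (g h : 'M[K]_n) : g *m h = 1%:M -> invmx g = h.
Proof.
move=> gh; have [gu _] := mulmx1_unit gh.
by rewrite -[RHS](mulKmx gu) gh mulmx1.
Qed.

Lemma gmx_act_var (m : nat) (xi : K) (s : Gmmn m n xi) :
  m.-primitive_root xi ->
  exists (t : {perm 'I_n}) (z : 'I_n -> K),
    forall j, z j ^+ m = 1 /\ Defs.act (gmx s) 'X_j = z j *: 'X_(t j).
Proof.
move=> xiP; have nz (k : nat) : xi ^+ k != 0 by apply: prim_expr_neq0 xiP.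
(* [N] is the inverse of [gmx s]. Since $\mathfrak{h}^*$ carries the inverse matrix, the variables
   are permuted by the inverse of [s.1]. *)
pose N : 'M[K]_n := \matrix_(i, j) if i == s.1 j then (xi ^+ s.2 j)^-1 else 0.
have /invmx_uniq sN : gmx s *m N = 1%:M.
  apply/matrixP=> i j; rewrite !mxE (bigD1 (s.1 i)) //= big1 => [|k ki].
    rewrite !mxE eqxx addr0 (inj_eq perm_inj).
    by have [->|_] := eqVneq i j; rewrite ?mulr0 // divff.
  by rewrite !mxE (negPf ki) mul0r.
exists (s.1^-1)%g, (fun j => (xi ^+ s.2 ((s.1^-1)%g j))^-1) => j; split.
  by rewrite exprVn exprAC (prim_expr_order xiP) expr1n invr1.
rewrite act_var sN; apply: linform_delta => k; rewrite !mxE.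
have -> : (j == s.1 k) = (k == (s.1^-1)%g j)
  by rewrite -{1}(permKV s.1 j) (inj_eq perm_inj) eq_sym.
by have [->|] := eqVneq k.
Qed.

(** Squarefree monomials are indexed by subsets, so that dividing by a variable and permuting
    variables become set operations. *)
Definition xset (S : {set 'I_n}) : {mpoly K[n]} := \prod_(j in S) 'X_j.

Lemma xsetD1 j (S : {set 'I_n}) : j \in S -> xset S = 'X_j * xset (S :\ j).
Proof. by move=> jS; rewrite /xset (big_setD1 j). Qed.

Lemma xsetE S : xset S = 'X_[mesym1 S].
Proof.
rewrite mpolyXE_id /xset big_mkcond; apply: eq_bigr => j _.
by rewrite mnmE; case: (j \in S).
Qed.

Lemma xset_homog S : xset S \is #|S|.-homog.
Proof. by rewrite xsetE dhomogX /= mdeg_mesym1. Qed.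

Lemma xset_sqfree u : sqfree_monomial u ->
  exists2 S : {set 'I_n}, #|S| = mdeg u & 'X_[u] = xset S.
Proof.
move=> u1; exists [set j | u j == 1%N].
  rewrite mdegE -sum1_card big_mkcond; apply: eq_bigr => j _.
  by rewrite inE; have := u1 j; case: (u j) => [|[]].
rewrite xsetE; congr 'X_[_]; apply/mnmP=> j; rewrite mnmE inE.
by have := u1 j; case: (u j) => [|[]].
Qed.

Lemma elem_xmE m j :
  elem_xm K m n j = \sum_(S : {set 'I_n} | #|S| == j) xset S ^+ m.
Proof.
rewrite /elem_xm /mesym raddf_sum; apply: eq_bigr => S _ /=.
rewrite rmorph_prod /= /xset -prodrXl; apply: eq_bigr => k _.
by rewrite comp_mpolyXU -tnth_nth tnth_mktuple.
Qed.

Lemma elem_xm_homog m j : elem_xm K m n j \is (j * m).-homog.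
Proof.
rewrite elem_xmE; apply: rpred_sum => S /eqP <-.
exact/dhomogMn/xset_homog.
Qed.

Lemma act_xset g (t : {perm 'I_n}) (z : 'I_n -> K) S :
  (forall j, Defs.act g 'X_j = z j *: 'X_(t j)) ->
  Defs.act g (xset S) = (\prod_(j in S) z j) *: xset (t @: S).
Proof.
move=> gE; rewrite /Defs.act rmorph_prod /=.
rewrite (eq_bigr (fun j => z j *: 'X_(t j))) => [|j _]; last exact: gE.
rewrite scaler_prod /xset big_imset //=; exact: in2W perm_inj.
Qed.

(** The group permutes the subsets of size [j], and the scalars it introduces are $m$th roots of
    unity, which disappear in the $m$th powers. *)
Lemma act_elem_xm (m : nat) (xi : K) (s : Gmmn m n xi) j :
  m.-primitive_root xi ->
  Defs.act (gmx s) (elem_xm K m n j) = elem_xm K m n j.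
Proof.
move=> xiP; have [t [z tz]] := gmx_act_var s xiP.
rewrite elem_xmE /Defs.act raddf_sum /=.
rewrite [RHS](reindex_inj (imset_inj (@perm_inj _ t))) /=.
rewrite [RHS](eq_bigl (fun S : {set 'I_n} => #|S| == j)) => [|S]; last first.
  by rewrite card_imset //; apply: perm_inj.
apply: eq_bigr => S _; rewrite rmorphXn /=.
have /= := act_xset S (fun j => (tz j).2); rewrite /Defs.act => ->.
rewrite exprZn -prodrXl big1 ?scale1r // => k _; exact: (tz k).1.
Qed.

End MonomialAction.

(** * Reflections of $G(m,m,n)$: explicit matrices, enumeration and conjugacy *)

Section Reflections.

Variables (K : fieldType) (n : nat).
Implicit Types (a b : 'I_n) (z : K).

(** The linear form $x_a - z x_b$. It serves as the root of $s_{ab}^k$; the transpose taken with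
    $z^{-1}$ is the matching coroot. *)
Definition rvec a b z : 'rV[K]_n := delta_mx 0 a - z *: delta_mx 0 b.

(* The reflection s_{ab}^k, for [z = xi ^+ k]. *)
Definition reflmx a b z : 'M[K]_n :=
  1%:M - (rvec a b z^-1)^T *m rvec a b z.

Lemma rvecE a b z k : rvec a b z 0 k = (k == a)%:R - z * (k == b)%:R.
Proof. by rewrite !mxE eqxx. Qed.

Lemma reflmxE a b z i j :
  reflmx a b z i j = (i == j)%:R - rvec a b z^-1 0 i * rvec a b z 0 j.
Proof.
rewrite [LHS]mxE [X in _ + X]mxE [X in _ - X]mxE [1%:M _ _]mxE.
by rewrite big_ord1 [_^T _ _]mxE.
Qed.

Lemma reflmx_monomial a b z i j : a != b -> z != 0 ->
  reflmx a b z i j = if j == tperm a b i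
    then (if i == a then z else if i == b then z^-1 else 1) else 0.
Proof.
move=> ab z0; have ba : (b == a) = false by rewrite eq_sym (negPf ab).
pose simp := (mulr0, mul0r, mulr1, mul1r, subr0, sub0r, oppr0, opprK,
  mulNr, addr0, add0r).
rewrite reflmxE !rvecE; case: tpermP => [->|->|/eqP ia /eqP ib].
- rewrite eqxx (negPf ab) eq_sym !simp.
  have [->|ja] := eqVneq j a; first by rewrite (negPf ab) !simp subrr.
  by case: eqP; rewrite !simp.
- rewrite eqxx ba eq_sym !simp.
  have [->|ja] := eqVneq j a; first by rewrite (negPf ab) !simp.
  by case: eqP; rewrite !simp // mulrN mulVf ?subrr.
rewrite (negPf ia) (negPf ib) !simp eq_sym.
by case: eqP.
Qed.

Lemma reflmxK a b z : a != b -> z != 0 ->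
  reflmx a b z *m reflmx a b z = 1%:M.
Proof.
(* Root and coroot pair to 2, so $(1-uv)^2 = 1 - 2uv + u(vu)v = 1$. *)
move=> ab z0; have uv : rvec a b z *m (rvec a b z^-1)^T = 2%:R%:M.
  apply/matrixP=> i j; rewrite !ord1 mxE (bigD1 a) //= (bigD1 b) 1?eq_sym //=.
  rewrite big1 => [|k /andP[ka kb]]; last first.
    by rewrite rvecE (negPf ka) (negPf kb) mulr0 subr0 mul0r.
  rewrite [_^T _ _]mxE [_^T b _]mxE !rvecE !eqxx [b == a]eq_sym (negPf ab).
  by rewrite !mulr0 !mulr1 !subr0 !sub0r mulrNN divff // addr0 mul1r mxE.
rewrite /reflmx; move: (_^T) (rvec a b z) uv => u v uv.
rewrite mulmxBl mul1mx mulmxBr mulmx1 mulmxA -(mulmxA u v u) uv.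
rewrite mul_mx_scalar -scalemxAl scaler_nat mulr2n opprB.
by rewrite addrK subrK.
Qed.

(** Row [a] is nonzero, so in rank one every other row is a multiple of it. *)
Lemma rank1_minor (M : 'M[K]_n) i j a :
  \rank M = 1%N -> M a a != 0 -> M i j * M a a = M i a * M a j.
Proof.
move=> rM Maa; have sub : (row i M <= row a M)%MS.
  apply: submx_trans (row_sub i M) _.
  have [_] := mxrank_leqif_sup (row_sub a M); rewrite rM rank_rV => <-.
  suff -> : row a M != 0 by [].
  by apply: contraNneq Maa => /rowP/(_ a); rewrite !mxE => ->.
have /sub_rVP[l /rowP E] := sub.
have := E j; have := E a; rewrite !mxE => -> ->.
by rewrite mulrAC.
Qed.

Section InGmmn.

Variables (m : nat) (xi : K).
Hypothesis xiP : m.-primitive_root xi.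

Let nz (k : nat) : xi ^+ k != 0.
Proof. exact: prim_expr_neq0 xiP. Qed.

(** As [s] moves [a], the matrix $M = 1-s$ has $M_{aa}=1$, and rank one makes it the product of its
    column [a] and its row [a]. The row is read off directly; the column is found entry by entry. *)
Lemma refl_gmx (s : refl m n xi) a : s.1 a != a ->
  gmx s = reflmx a (s.1 a) (xi ^+ s.2 a).
Proof.
set b := s.1 a; set z := xi ^+ _ => ba; pose M := 1%:M - gmx s.
have rM : \rank M = 1%N by apply/eqP/rvalP.
have ME i j : M i j = (i == j)%:R - (if j == s.1 i then xi ^+ s.2 i else 0).
  by rewrite !mxE.
have Maa : M a a = 1 by rewrite ME eqxx eq_sym (negPf ba) subr0.
have Maj j : M a j = rvec a b z 0 j.
  rewrite ME rvecE eq_sym -/b -/z.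
  by have [->|_] := eqVneq j b; rewrite ?mulr1 ?mulr0.
have mn i j : M i j = M i a * M a j.
  by rewrite -[LHS]mulr1 -Maa; apply: rank1_minor; rewrite ?Maa ?oner_neq0.
suff Mia i : M i a = rvec a b z^-1 0 i.
  have -> : gmx s = 1%:M - M by rewrite /M opprB addrC subrK.
  by apply/matrixP=> i j; rewrite reflmxE -Mia -Maj -mn !mxE.
have [->|ia] := eqVneq i a.
  by rewrite Maa rvecE eqxx eq_sym (negPf ba) mulr0 subr0.
have [->|ib] := eqVneq i b.
  (* [s] also moves [b], so $M_{bb}=1$; comparing with $M_{ba}M_{ab} = -z M_{ba}$ gives $M_{ba} =
     -z^{-1}$. *)
  have sb : (b == s.1 b) = false by rewrite (inj_eq perm_inj) eq_sym (negPf ba).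
  have := mn b b; rewrite ME eqxx sb subr0 Maj !rvecE eqxx (negPf ba).
  rewrite !sub0r !mulr1 => e.
  apply: (@mulIf _ (- z)); first by rewrite oppr_eq0 nz.
  by rewrite -e mulrNN mulVf ?nz.
rewrite rvecE (negPf ia) (negPf ib) mulr0 subr0.
have [si|si] := eqVneq (s.1 i) i.
  by rewrite ME si (negPf ia) eq_sym (negPf ia) subr0.
(* A third moved index would have $M_{ii}=1$, whereas $M_{ia}M_{ai}=0$. *)
have /eqP := mn i i.
rewrite {1}ME eqxx [i == s.1 i]eq_sym (negPf si) subr0 Maj rvecE.
by rewrite (negPf ia) (negPf ib) mulr0 subr0 mulr0 oner_eq0.
Qed.

(** Otherwise [s] is diagonal, and rank one leaves a single entry different from 1; the condition
    that the entries have product 1 rules this out. *)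
Lemma refl_moves (s : refl m n xi) : exists a, s.1 a != a.
Proof.
apply/existsP; apply: contraT; rewrite negb_exists => /forallP s1.
have {}s1 i : s.1 i = i by apply/eqP; rewrite -[_ == _]negbK.
pose M := 1%:M - gmx s; have rM : \rank M = 1%N by apply/eqP/rvalP.
have ME i j : M i j = if i == j then 1 - xi ^+ s.2 i else 0.
  by rewrite !mxE s1 eq_sym; case: eqP => // _; rewrite subr0.
have [a Ma|M0] := pickP (fun a => M a a != 0); last first.
  suff M_eq0 : M = 0 by rewrite M_eq0 mxrank0 in rM.
  apply/matrixP=> i j; rewrite [RHS]mxE ME; case: eqP => // _.
  by have /negbFE/eqP := M0 i; rewrite ME eqxx.
have d0 i : i != a -> xi ^+ s.2 i = 1.
  move=> ia; have /eqP := rank1_minor i i rM Ma.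
  rewrite [M i a]ME (negPf ia) mul0r mulf_eq0 (negPf Ma) orbF ME eqxx subr_eq0.
  by move/eqP.
have := gvalP s; rewrite (bigD1 a) //= big1 // mulr1 => /eqP da.
by rewrite ME eqxx da subrr eqxx in Ma.
Qed.

Lemma reflmx_refl a b z : a != b -> z ^+ m = 1 ->
  exists s : refl m n xi, gmx s = reflmx a b z.
Proof.
move=> ab zm; have z0 : z != 0.
  apply: contra_eq_neq zm => ->.
  by rewrite expr0n gtn_eqF ?(prim_order_gt0 xiP) // eq_sym oner_eq0.
have rE i j := reflmx_monomial i j ab z0.
have [|g gE] := (gmxP (reflmx a b z) xiP).2.
  exists (tperm a b); split=> [i j|i|].
  - rewrite rE; have [_|_] := eqVneq j; last by rewrite eqxx.
    by case: ifP => // _; case: ifP => _; rewrite ?invr_neq0 ?oner_eq0.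
  - rewrite rE eqxx; case: ifP => // _; case: ifP => _; last exact: expr1n.
    by rewrite exprVn zm invr1.
  rewrite (bigD1 a) //= (bigD1 b) 1?eq_sym //= big1 => [|k /andP[ka kb]].
    by rewrite !rE !eqxx [b == a]eq_sym (negPf ab) mulr1 divff.
  by rewrite rE eqxx (negPf ka) (negPf kb).
have r1 : \rank (1%:M - gmx g) == 1%N.
  have -> : 1%:M - gmx g = (rvec a b z^-1)^T *m rvec a b z.
    by rewrite gE /reflmx opprB addrC subrK.
  rewrite eqn_leq mulmx_max_rank lt0n mxrank_eq0; apply/eqP=> /matrixP/(_ a a).
  rewrite mxE big_ord1 [_^T _ _]mxE !rvecE eqxx (negPf ab) !mulr0 !subr0.
  by rewrite mulr1 mxE; apply/eqP/oner_neq0.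
by exists (MkRefl r1).
Qed.

Lemma refl_inj (s t : refl m n xi) a :
  s.1 a != a -> s.1 a = t.1 a -> s.2 a = t.2 a -> s = t.
Proof.
move=> sa s1 s2; apply/val_inj/(gmx_inj xiP).
by rewrite (refl_gmx sa) s1 s2 -refl_gmx // -s1.
Qed.

(** The coordinate [a] of a Dunkl operator only sees reflections moving [a]. These are parametrised
    by the image [b] of [a] and the exponent [k], without the ordering $a<b$. *)
Lemma sum_refl (V : nmodType) (F : refl m n xi -> V) (G : 'I_n -> K -> V) a :
  (forall s : refl m n xi, s.1 a = a -> F s = 0) ->
  (forall s : refl m n xi, s.1 a != a -> F s = G (s.1 a) (xi ^+ s.2 a)) ->
  \sum_s F s = \sum_(b | b != a) \sum_(k < m) G b (xi ^+ k).
Proof.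
move=> F0 FG; rewrite pair_big_dep /=.
rewrite (bigID (fun s : refl m n xi => s.1 a != a)) /=.
rewrite [X in _ + X]big1 ?addr0 => [|s /negPn/eqP/F0 //].
(* The pair (image of [a], exponent at [a]) determines the reflection, so each block consists of the
   single [t] built below. *)
rewrite (partition_big (fun s : refl m n xi => (s.1 a, s.2 a))
  (fun u : 'I_n * 'I_m => (u.1 != a) && true)) => [|s ->] //=.
apply: eq_bigr => -[b k] /=; rewrite andbT => ba.
have [||t tE] := @reflmx_refl a b (xi ^+ k); first by rewrite eq_sym.
  by rewrite exprAC (prim_expr_order xiP) expr1n.
have ab : a != b by rewrite eq_sym.
have ta : t.1 a = b /\ t.2 a = k.
  have rE j := reflmx_monomial a j ab (nz k).
  have := rE b; rewrite -tE tpermL eqxx [gmx t _ _]mxE.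
  have [<-|_] := eqVneq b (t.1 a); last first.
    by rewrite eqxx => /esym/eqP; rewrite (negPf (nz k)).
  rewrite eqxx => /eqP; rewrite (eq_prim_root_expr xiP) !modn_small //.
  by move=> /eqP e; split=> //; apply: val_inj.
rewrite (big_pred1 t) => [|s]; first by rewrite FG ta.1 // ta.2.
apply/andP/eqP => [[sa /eqP[e1 e2]]|->]; last by rewrite ta.1 ta.2 eqxx.
by apply: (refl_inj sa); rewrite ?ta.1 ?ta.2.
Qed.

(** The conjugating matrix swaps [b] and [b'] and rescales by the ratio [w] of the two roots of
    unity. A further index is needed to bring the product of its entries back to 1, hence $n>2$. *)
Lemma refl_conj (s t : refl m n xi) a : (2 < n)%N ->
  s.1 a != a -> t.1 a != a -> conj_refl s t.
Proof.
move=> n3 sa ta; rewrite /conj_refl (refl_gmx sa) (refl_gmx ta).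
set b := s.1 a in sa *; set b' := t.1 a in ta *.
set z := xi ^+ s.2 a; set z' := xi ^+ t.2 a; pose w := z / z'.
have w0 : w != 0 by rewrite mulf_neq0 ?invr_eq0 ?nz.
have wm : w ^+ m = 1.
  rewrite exprMn exprVn ![_ ^+ _ ^+ m]exprAC (prim_expr_order xiP) !expr1n.
  by rewrite invr1 mulr1.
(* The index [e] absorbs $w^{-1}$. It may equal [b], but not [a], where the entry must be 1. *)
have [e] : exists e, e \notin [set a; b'].
  apply/existsP; apply: contraLR n3.
  rewrite negb_exists -leqNgt => /forallP full.
  have : (#|[set: 'I_n]| <= #|[set a; b']|)%N.
    by apply/subset_leq_card/subsetP => e _; rewrite -[_ \in _]negbK.
  rewrite cardsT card_ord cards2 => /leq_trans; apply.
  by case: (_ != _).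
rewrite !inE negb_or => /andP[ea eb'].
pose D i := if i == b' then w else if i == e then w^-1 else 1.
have D0 i : D i != 0 by rewrite /D; do 2?case: ifP; rewrite ?invr_eq0 ?oner_eq0.
have Db' : D b' = w by rewrite /D eqxx.
have Da : D a = 1 by rewrite /D !(eq_sym a) (negPf ta) (negPf ea).
pose A : 'M[K]_n := \matrix_(i, j) if j == tperm b b' i then D i else 0.
have [|g gE] := (gmxP A xiP).2.
  exists (tperm b b'); split=> [i j|i|].
  - by rewrite mxE; have [_|_] := eqVneq j; rewrite ?D0 ?eqxx.
  - rewrite mxE eqxx /D; do 2?[case: ifP => _ //]; last exact: expr1n.
    by rewrite exprVn wm invr1.
  rewrite (bigD1 b') //= (bigD1 e) //= big1 => [|k /andP[kb ke]].
    by rewrite !mxE !eqxx Db' /D (negPf eb') eqxx mulr1 divff.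
  by rewrite mxE eqxx /D (negPf kb) (negPf ke).
have bD : b' = b -> D b = w by move=> <-.
pose simp := (mulr0, mul0r, mulr1, mul1r, subr0, sub0r, addr0,
  add0r, mulrN, mulNr).
have wz : w * z^-1 = z'^-1 by rewrite /w mulrAC divff ?nz ?mul1r.
have zw : z' * w = z by rewrite /w mulrCA divff ?nz ?mulr1.
(* The identity parts agree. For the rank one parts, [A] sends the coroot of [s] to that of [t], and
   the root of [t] times [A] is the root of [s]. *)
exists g; rewrite gE /reflmx mulmxBr mulmxBl mulmx1 mul1mx; congr (_ - _).
have -> : A *m ((rvec a b z^-1)^T *m rvec a b z) =
          (rvec a b' z'^-1)^T *m rvec a b z.
  rewrite mulmxA; congr (_ *m _); apply/colP=> i; rewrite mxE.
  rewrite (bigD1 (tperm b b' i)) //= big1 => [|k ki]; last first.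
    by rewrite mxE (negPf ki) mul0r.
  rewrite addr0 mxE eqxx [_^T _ _]mxE [RHS]mxE !rvecE.
  case: tpermP => [->|->|/eqP ib /eqP ib'].
  - rewrite (negPf sa) (negPf ta) [b == b']eq_sym !simp.
    by case: eqP => [/bD ->|_]; rewrite !simp ?oppr0 // wz.
  - by rewrite Db' !eqxx (negPf sa) (negPf ta) !simp wz.
  rewrite (negPf ib) (negPf ib') !simp.
  by have [->|_] := eqVneq i a; rewrite ?Da !simp.
rewrite -mulmxA; congr (_ *m _); apply/rowP=> j.
rewrite [RHS]mxE (bigD1 (tperm b b' j)) //= big1 => [|k kj]; last first.
  rewrite [A _ _]mxE -(inj_eq (@perm_inj _ (tperm b b'))) tpermK.
  by rewrite eq_sym (negPf kj) mulr0.
rewrite [A _ _]mxE tpermK eqxx !rvecE addr0.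
case: tpermP => [->|->|/eqP jb /eqP jb'].
- by rewrite Db' !eqxx (negPf sa) (negPf ta) !simp zw.
- rewrite (negPf sa) (negPf ta) [b == b']eq_sym !simp.
  by case: eqP => [/bD ->|_]; rewrite !simp // zw.
rewrite (negPf jb) (negPf jb') !simp.
by have [->|_] := eqVneq j a; rewrite ?Da !simp.
Qed.

End InGmmn.

End Reflections.

(** * Dunkl operators on the generators of $J'$ *)

Section Dunkl.

Variables (K : fieldType) (m n : nat) (xi : K) (c : refl m n xi -> K).
Hypothesis xiP : m.-primitive_root xi.

Lemma dunkl_coord y f :
  dunkl c y f =
  - \sum_a y a 0 *: \sum_s c s *: (Defs.root s 0 a *: divdiff s f).
Proof.
rewrite /dunkl; congr (- _); under [RHS]eq_bigr => a _ do rewrite scaler_sumr.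
rewrite exchange_big /=; apply: eq_bigr => s _; rewrite /pairing mxE.
rewrite mulr_sumr scaler_suml; apply: eq_bigr => a _.
by rewrite !scalerA [_ * y a 0]mulrC mulrCA mulrA.
Qed.

Lemma root_moved (s : refl m n xi) a : s.1 a != a ->
  Defs.root s = Defs.root s 0 a *: rvec a (s.1 a) (xi ^+ s.2 a).
Proof.
move=> sa; have sE := refl_gmx xiP sa.
have ab : a != s.1 a by rewrite eq_sym.
have z0 : xi ^+ s.2 a != 0 by apply: prim_expr_neq0 xiP.
have : (Defs.root s <= rvec a (s.1 a) (xi ^+ s.2 a))%MS.
  rewrite (eqmxP (root_span s)) sE (invmx_uniq (reflmxK ab z0)).
  by rewrite /reflmx opprB addrC subrK submxMl.
move=> /sub_rVP[l lE]; rewrite {1}lE; congr (_ *: _).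
by rewrite lE mxE rvecE eqxx (negPf ab) mulr0 subr0 mulr1.
Qed.

(** The root is supported on some moved index [b] and its image, and a fixed [a] is neither. *)
Lemma root_fixed (s : refl m n xi) a : s.1 a = a -> Defs.root s 0 a = 0.
Proof.
move=> sa; have [b sb] := refl_moves s.
have ab : (a == b) = false by apply: contraNF sb => /eqP <-; apply/eqP.
have asb : (a == s.1 b) = false by rewrite -{1}sa (inj_eq perm_inj).
by rewrite (root_moved sb) mxE rvecE ab asb mulr0 subr0 mulr0.
Qed.

Lemma linform_rvec (a b : 'I_n) z :
  linform (rvec a b z) = 'X_a - z *: 'X_b :> {mpoly K[n]}.
Proof.
rewrite /linform.
rewrite (eq_bigr (fun k => (k == a)%:R *: 'X_k - z *: ((k == b)%:R *: 'X_k))).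
  rewrite sumrB -scaler_sumr (bigD1 a) //= eqxx scale1r big1 => [|k ka].
    rewrite addr0 (bigD1 b) //= eqxx scale1r big1 ?addr0 // => k kb.
    by rewrite (negPf kb) scale0r.
  by rewrite (negPf ka) scale0r.
by move=> k _; rewrite rvecE scalerBl scalerA.
Qed.

Lemma divdiff_root (s : refl m n xi) a f : s.1 a != a ->
  (Defs.root s 0 a *: divdiff s f) * ('X_a - xi ^+ s.2 a *: 'X_(s.1 a)) =
  f - Defs.act (gmx s) f.
Proof.
move=> sa; rewrite -linform_rvec -(divdiffE s f) (root_moved sa).
rewrite -scalerAl scalerAr; congr (_ * _); rewrite mxE rvecE eqxx.
rewrite eq_sym (negPf sa) mulr0 subr0 mulr1 /linform scaler_sumr.
by apply: eq_bigr => k _; rewrite scalerA [in RHS]mxE.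
Qed.

Lemma moved_linform_neq0 (s : refl m n xi) a : s.1 a != a ->
  'X_a - xi ^+ s.2 a *: 'X_(s.1 a) != 0 :> {mpoly K[n]}.
Proof.
move=> sa; apply/eqP=> /(congr1 (mcoeff U_(a))).
rewrite mcoeffB mcoeffZ !mcoeffXU.
by rewrite mcoeff0 eqxx (negPf sa) mulr0 subr0; apply/eqP/oner_neq0.
Qed.

Lemma act_refl_var (s : refl m n xi) a j : s.1 a != a ->
  Defs.act (gmx s) 'X_j =
  (if j == a then xi ^+ s.2 a else if j == s.1 a then (xi ^+ s.2 a)^-1 else 1)
    *: 'X_(tperm a (s.1 a) j).
Proof.
move=> sa; have ab : a != s.1 a by rewrite eq_sym.
have z0 : xi ^+ s.2 a != 0 by apply: prim_expr_neq0 xiP.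
rewrite act_var (refl_gmx xiP sa) (invmx_uniq (reflmxK ab z0)).
by apply: linform_delta => k; rewrite mxE reflmx_monomial.
Qed.

Lemma act_refl_xset (s : refl m n xi) a (S : {set 'I_n}) : s.1 a != a ->
  a \notin S -> s.1 a \notin S -> Defs.act (gmx s) (xset K S) = xset K S.
Proof.
move=> sa aS bS; rewrite /Defs.act rmorph_prod /=; apply: eq_bigr => j jS.
have ja : j != a by apply: contraNneq aS => <-.
have jb : j != s.1 a by apply: contraNneq bS => <-.
have := act_refl_var j sa; rewrite /Defs.act => ->.
by rewrite (negPf ja) (negPf jb) scale1r tpermD // eq_sym.
Qed.

(* The quotient of [(1 - s) x^S] by [x_a - z x_b], for [s] the reflection
   [x_a |-> z x_b], [x_b |-> z^-1 x_a]. *)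
Definition xset_quot (S : {set 'I_n}) (a b : 'I_n) (z : K) : {mpoly K[n]} :=
  if a \in S then if b \in S then 0 else xset K (S :\ a)
  else if b \in S then - z^-1 *: xset K (S :\ b) else 0.

Lemma divdiff_xset (s : refl m n xi) a S : s.1 a != a ->
  Defs.root s 0 a *: divdiff s (xset K S) =
  xset_quot S a (s.1 a) (xi ^+ s.2 a).
Proof.
move=> sa; apply: (mulIf (moved_linform_neq0 sa)).
apply: etrans (divdiff_root (xset K S) sa) _.
have aX := act_refl_var a sa; have bX := act_refl_var (s.1 a) sa.
have SX := @act_refl_xset s a ^~ sa.
have z0 : xi ^+ s.2 a != 0 by apply: prim_expr_neq0 xiP.
have aM (f g : {mpoly K[n]}) :
    Defs.act (gmx s) (f * g) = Defs.act (gmx s) f * Defs.act (gmx s) g.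
  exact: rmorphM.
move: sa aX bX SX z0; rewrite /xset_quot; set b := s.1 a; set z := xi ^+ _.
move=> ba; rewrite eqxx (negPf ba) tpermL eqxx tpermR => aX bX SX z0.
have [aS|aS] := boolP (a \in S); have [bS|bS] := boolP (b \in S).
(* With both indices in [S] the factors $z$ and $z^{-1}$ cancel, and the monomial is fixed. *)
- have bSa : b \in S :\ a by rewrite !inE ba.
  rewrite (xsetD1 _ aS) (xsetD1 _ bSa) !aM aX bX SX ?inE ?eqxx ?andbF //.
  rewrite -!scalerAl -scalerAr scalerA mulfV // scale1r mulrCA.
  by rewrite subrr mul0r.
- rewrite (xsetD1 _ aS) !aM aX SX ?inE ?eqxx ?(negPf bS) ?andbF //.
  by rewrite -mulrBl mulrC.
(* Here $x_b - z^{-1}x_a = -z^{-1}(x_a - z x_b)$. *)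
- rewrite (xsetD1 _ bS) !aM bX SX ?inE ?eqxx ?(negPf aS) ?andbF //.
  rewrite -mulrBl mulrC -scalerAl scalerAr; congr (_ * _).
  by rewrite scaleNr scalerBr scalerA mulVf // scale1r opprB.
by rewrite SX // subrr mul0r.
Qed.

(** Geometric sum: $\xi^{-1}$ is a root of $X^m-1$ different from 1. *)
Lemma sum_expr_primV : (1 < m)%N -> \sum_(k < m) (xi ^+ k)^-1 = 0.
Proof.
move=> m1; have xi1 : xi^-1 - 1 != 0.
  rewrite subr_eq0 invr_eq1 -(expr1 xi) -(expr0 xi) (eq_prim_root_expr xiP).
  by rewrite modn_small // mod0n.
have : xi^-1 ^+ m - 1 = 0 by rewrite exprVn (prim_expr_order xiP) invr1 subrr.
rewrite subrX1 => /eqP; rewrite mulf_eq0 (negPf xi1) /= => /eqP e.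
by rewrite -[RHS]e; apply: eq_bigr => k _; rewrite exprVn.
Qed.

Lemma dunkl_xsetT y : dunkl c y (xset K setT) = 0.
Proof.
rewrite dunkl_coord big1 ?oppr0 // => a _; rewrite big1 ?scaler0 // => s _.
have [sa|sa] := eqVneq (s.1 a) a.
  by rewrite root_fixed // scale0r scaler0.
by rewrite divdiff_xset // /xset_quot !inE scaler0.
Qed.

Lemma dunkl_xset y S : class_param c -> (1 < m)%N -> (2 < n)%N ->
  #|~: S|%:R = 0 :> K -> dunkl c y (xset K S) = 0.
Proof.
move=> cc m1 n3 S0; rewrite dunkl_coord big1 ?oppr0 // => a _.
(* [C] is the common parameter of the reflections moving [a]; 0 is a default if there are none. *)
have [C CE] : exists C, forall s : refl m n xi, s.1 a != a -> c s = C.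
  have [s sa|s0] := pickP (fun s : refl m n xi => s.1 a != a); last first.
    by exists 0 => s; rewrite s0.
  by exists (c s) => t ta; apply: cc; apply: refl_conj ta sa.
rewrite (@sum_refl _ _ _ _ xiP _ _ (fun b z => C *: xset_quot S a b z) a).
- rewrite -[RHS](scaler0 _ (y a 0)); congr (_ *: _); rewrite /xset_quot.
  (* For [a] in [S], each [b] outside [S] contributes the same term, and their number vanishes in
     [K]. For [a] outside [S], each [b] in [S] contributes a multiple of the sum of all
     $\xi^{-k}$. *)
  have [aS|aS] := boolP (a \in S).
    rewrite (bigID (mem S)) /= big1 => [|b /andP[_ ->]]; last first.
      by rewrite big1 // => k _; rewrite scaler0.
    rewrite add0r (eq_big (mem (~: S)) (fun=> (C *: xset K (S :\ a)) *+ m)).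
    + by rewrite sumr_const -[LHS]scaler_nat S0 scale0r.
    + move=> b; rewrite !inE andb_idl //; apply: contraNneq => ->; exact: aS.
    move=> b /andP[_ /negPf->]; by rewrite sumr_const card_ord.
  rewrite big1 // => b _.
  have [bS|bS] := boolP (b \in S); last first.
    by rewrite big1 // => k _; rewrite scaler0.
  rewrite -scaler_sumr -scaler_suml sumrN sum_expr_primV //.
  by rewrite oppr0 scale0r scaler0.
- by move=> s sa; rewrite root_fixed // scale0r scaler0.
by move=> s sa; rewrite CE // divdiff_xset.
Qed.

Lemma dunkl_elem_xm y j : dunkl c y (elem_xm K m n j) = 0.
Proof.
rewrite /dunkl big1 ?oppr0 // => s _.
suff -> : divdiff s (elem_xm K m n j) = 0 by rewrite scaler0.
apply: (mulIf (root_neq0 s)); apply: etrans (divdiffE _ _) _.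
by rewrite act_elem_xm // subrr mul0r.
Qed.

End Dunkl.

(** * Checking the submodule criterion on the generators of $J'$ *)

Theorem lemma6p3 (K : fieldType) (p m n i : nat) (xi : K)
  (hp : p \in [pchar K]) (hm : (1 < m)%N) (hpm : ~~ (p %| m)%N)
  (hxi : m.-primitive_root xi)
  (hn : (1 <= n)%N) (hpn : ~~ (p %| n)%N)
  (hi : (0 < i < p)%N) (hni : n = i %[mod p])
  (c : refl m n xi -> K) (hc : generic_param c)
  (J : {mpoly K[n]} -> Prop) (hJ : maximal_proper_graded_submodule c J) :
  forall f : {mpoly K[n]}, J' m i f -> J f.
Proof.
case/andP: hi => i0 ip; have [cc _] := hc.
move=> f; apply: (pgs_sub_maximal hJ); apply: ideal_gen_pgs.
- move=> g [[j [/andP[j1 _] ->]]|[u [_ ui ->]]].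
    exists (j * m)%N; last exact: elem_xm_homog.
    by rewrite muln_gt0 j1 ltnW.
  by exists i => //; rewrite dhomogX /= ui.
- move=> y g [[j [_ ->]]|[u [/(@xset_sqfree K)[S uS uE] ui ->]]].
    by apply: dunkl_elem_xm.
  rewrite uE; rewrite {}ui in uS.
  have cS : (i + #|~: S| = n)%N by rewrite -uS cardsC card_ord.
  have pS : (p %| #|~: S|)%N.
    by rewrite -(addKn i #|~: S|) cS -eqn_mod_dvd ?hni // -[leqRHS]cS leq_addr.
  (* A nonempty complement has at least $p\ge 2$ elements, and $i\ge 1$, so $n\ge 3$ and
     [dunkl_xset] applies. *)
  have [S0|S0] := posnP #|~: S|.
    have -> : S = setT by rewrite -[S]setCK (cards0_eq S0) setC0.
    by apply: dunkl_xsetT.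
  apply: dunkl_xset => //; last by apply/eqP; rewrite -(dvdn_pcharf hp).
  rewrite -[ltnRHS]cS -[3%N]/(1 + 2)%N leq_add //.
  exact: leq_trans (leq_ltn_trans i0 ip) (dvdn_leq S0 pS).
move=> s g [[j [jn ->]]|[u [/(@xset_sqfree K)[S uS uE] ui ->]]].
  by rewrite act_elem_xm //; apply: ideal_gen_mem; left; exists j.
have [t [z tz]] := gmx_act_var s hxi.
rewrite uE (act_xset S (fun j => (tz j).2)); apply/ideal_genZ/ideal_gen_mem.
right; exists (mesym1 (t @: S)); rewrite xsetE mdeg_mesym1 card_imset ?uS //.
  by split=> // k; rewrite mnmE leq_b1.
exact: perm_inj.
Qed.
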